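(* Let $n\ge1$, let $\alpha\ge0$ be real and let $z_1,\ldots,z_n\in\mathbb{C}$ satisfy $z_1+\cdots+z_n=1$. For integers $s_1,\ldots,s_n\ge0$ define $$S_s(z;\alpha)=\sum_{k=1}^{n} z_k^{s_k+1}\sum_{\substack{0\le j_i\le s_i\\ i\ne k}}\frac{\Gamma\big(\alpha+s_k+\sum_{i\ne k}j_i+1\big)}{\Gamma(\alpha+1)\,s_k!\prod_{i\ne k}j_i!}\prod_{i\ne k}z_i^{j_i}.$$ Then, as formal power series in $t_1,\ldots,t_n$, $$\sum_{s_1,\ldots,s_n\ge0}S_s(z;\alpha)\,t_1^{s_1}\cdots t_n^{s_n}=\Big(1-\sum_{i=1}^n z_it_i\Big)^{-\alpha}\prod_{i=1}^{n}(1-t_i)^{-1}.$$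
   Context: $s=(s_1,\ldots,s_n)$; the inner sum runs over all $(j_i)_{i\ne k}$ with $0\le j_i\le s_i$. *)

(* Defs.v *)
From HB Require Import structures.
From mathcomp Require Import all_boot all_order all_algebra.
From mathcomp Require Import all_classical all_reals all_analysis.
From mathcomp.real_closed Require Import complex.

Set Implicit Arguments.
Unset Strict Implicit.
Unset Printing Implicit Defensive.

Import Order.TTheory GRing.Theory Num.Theory.

Local Open Scope ring_scope.

Notation mindex n := {ffun 'I_n -> nat}.

Definition mdeg n (s : mindex n) : nat := (\sum_i s i)%N.

(* Finite carrier for sums over multi-indices with all entries at most [N]. *)
Definition mbox n N := {ffun 'I_n -> 'I_N.+1}.

Definition mval n N (a : mbox n N) : mindex n := [ffun i => a i : nat].

Section MultiIndex.
Variable n : nat.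
Implicit Types (s t : mindex n) (N : nat).

Lemma mdegD s t : mdeg (s + t) = (mdeg s + mdeg t)%N.
Proof. by rewrite /mdeg -big_split; apply: eq_bigr => i _; rewrite ffunE. Qed.

Lemma mdeg0 : mdeg (0 : mindex n) = 0%N.
Proof. by rewrite /mdeg big1 // => i _; rewrite ffunE. Qed.

Lemma mdeg_eq0 s : (mdeg s == 0%N) = (s == 0).
Proof.
rewrite /mdeg sum_nat_eq0; apply/forallP/eqP => [h|-> i]; last by rewrite ffunE.
by apply/ffunP => i; rewrite ffunE; apply/eqP/(implyP (h i)).
Qed.

Lemma leq_mdeg s i : (s i <= mdeg s)%N.
Proof. by rewrite /mdeg (bigD1 i) //= leq_addr. Qed.

Lemma mval_inj N : injective (@mval n N).
Proof.
move=> a b /ffunP ab; apply/ffunP => i; apply/val_inj.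
by have := ab i; rewrite !ffunE.
Qed.

Lemma mval_le N (a : mbox n N) i : (mval a i <= N)%N.
Proof. by rewrite ffunE -ltnS. Qed.

Lemma mvalP N s : (forall i, (s i <= N)%N) -> exists a : mbox n N, mval a = s.
Proof.
move=> h; exists [ffun i => inord (s i)].
by apply/ffunP => i; rewrite !ffunE inordK // ltnS.
Qed.

Lemma maddl_le N s t u : s + t = u -> (forall i, (u i <= N)%N) ->
  forall i, (s i <= N)%N.
Proof.
by move=> <- h i; apply: leq_trans (h i); rewrite ffunE; apply: leq_addr.
Qed.

Lemma maddr_le N s t u : s + t = u -> (forall i, (u i <= N)%N) ->
  forall i, (t i <= N)%N.
Proof. by rewrite addrC; apply: maddl_le. Qed.

Lemma madd_eq0 s t : (s + t == 0) = (s == 0) && (t == 0).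
Proof. by rewrite -!mdeg_eq0 mdegD addn_eq0. Qed.

Lemma mdeg_ler s t u : s + t = u -> (mdeg t <= mdeg u)%N.
Proof. by move=> <-; rewrite mdegD leq_addl. Qed.

Lemma mdeg_ltr s t u : s + t = u -> s != 0 -> (mdeg t < mdeg u)%N.
Proof. by move=> <-; rewrite mdegD -add1n leq_add2r lt0n mdeg_eq0. Qed.

Lemma big_mbox (R : nmodType) M N s (F : mindex n -> mindex n -> R) :
  (forall i, (s i <= M)%N) -> (forall i, (s i <= N)%N) ->
  \sum_(p : mbox n M * mbox n M | mval p.1 + mval p.2 == s)
     F (mval p.1) (mval p.2) =
  \sum_(p : mbox n N * mbox n N | mval p.1 + mval p.2 == s)
     F (mval p.1) (mval p.2).
Proof.
pose m K (p : mbox n K * mbox n K) := (mval p.1, mval p.2).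
pose l K := [seq m K p | p <- index_enum (mbox n K * mbox n K)%type].
have lE K : \sum_(p : mbox n K * mbox n K | mval p.1 + mval p.2 == s)
     F (mval p.1) (mval p.2) = \sum_(q <- l K | q.1 + q.2 == s) F q.1 q.2.
  by rewrite big_map.
move=> hM hN; rewrite !lE -[LHS]big_filter -[RHS]big_filter; apply: perm_big.
have ul K : uniq (l K).
  rewrite map_inj_uniq ?index_enum_uniq // => -[a b] [c d] [].
  by move=> /mval_inj -> /mval_inj ->.
apply: uniq_perm; rewrite ?filter_uniq // => -[u v].
have inl K : (forall i, (s i <= K)%N) -> u + v = s -> (u, v) \in l K.
  move=> hK uvs.
  have [a ua] := mvalP (maddl_le uvs hK); have [b vb] := mvalP (maddr_le uvs hK).
  by apply/mapP; exists (a, b); rewrite ?mem_index_enum // /m /= ua vb.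
rewrite !mem_filter /=; case: eqP => //= uvs.
by rewrite !inl.
Qed.

End MultiIndex.

Record mfps (R : Type) (n : nat) := MFPS { mcoef : mindex n -> R }.

Notation "'{mfps' R [ n ] }" := (mfps R n)
  (at level 0, R at level 2, n at level 2, format "{mfps  R [ n ] }").

Lemma mfpsP (R : Type) n (f g : {mfps R[n]}) : mcoef f =1 mcoef g -> f = g.
Proof. by case: f g => [f] [g] /= /funext ->. Qed.

HB.instance Definition _ (R : Type) n := gen_eqMixin {mfps R[n]}.
HB.instance Definition _ (R : Type) n := gen_choiceMixin {mfps R[n]}.

Section MFPSZmod.
Variables (R : zmodType) (n : nat).
Implicit Types f g h : {mfps R[n]}.

Definition mfps_zero : {mfps R[n]} := MFPS (fun=> 0).
Definition mfps_opp f : {mfps R[n]} := MFPS (fun s => - mcoef f s).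
Definition mfps_add f g : {mfps R[n]} := MFPS (fun s => mcoef f s + mcoef g s).

Fact mfps_addA : associative mfps_add.
Proof. by move=> f g h; apply: mfpsP => s /=; rewrite addrA. Qed.
Fact mfps_addC : commutative mfps_add.
Proof. by move=> f g; apply: mfpsP => s /=; rewrite addrC. Qed.
Fact mfps_add0 : left_id mfps_zero mfps_add.
Proof. by move=> f; apply: mfpsP => s /=; rewrite add0r. Qed.
Fact mfps_addN : left_inverse mfps_zero mfps_opp mfps_add.
Proof. by move=> f; apply: mfpsP => s /=; rewrite addNr. Qed.

HB.instance Definition _ := GRing.isZmodule.Build {mfps R[n]}
  mfps_addA mfps_addC mfps_add0 mfps_addN.

Lemma mcoef0 s : mcoef (0 : {mfps R[n]}) s = 0. Proof. by []. Qed.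
Lemma mcoefD f g s : mcoef (f + g) s = mcoef f s + mcoef g s.
Proof. by []. Qed.
Lemma mcoefN f s : mcoef (- f) s = - mcoef f s. Proof. by []. Qed.
Lemma mcoefB f g s : mcoef (f - g) s = mcoef f s - mcoef g s.
Proof. by []. Qed.
Lemma mcoef_sum I (r : seq I) (P : pred I) (F : I -> {mfps R[n]}) s :
  mcoef (\sum_(i <- r | P i) F i) s = \sum_(i <- r | P i) mcoef (F i) s.
Proof. exact: (big_morph (fun f => mcoef f s)). Qed.

End MFPSZmod.

Section MFPSRing.
Variables (R : comNzRingType) (n : nat).
Implicit Types (f g h : {mfps R[n]}) (s : mindex n) (c : R).

Definition mfps_one : {mfps R[n]} := MFPS (fun s => (s == 0)%:R).

(* Both entries of a pair of multi-indices with sum [s] are bounded by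
   [mdeg s], so that the sum below runs over all such pairs. *)
Definition mfps_mul f g : {mfps R[n]} := MFPS (fun s =>
  \sum_(p : mbox n (mdeg s) * mbox n (mdeg s) | mval p.1 + mval p.2 == s)
     mcoef f (mval p.1) * mcoef g (mval p.2)).

Lemma mfps_mulE N f g s : (forall i, (s i <= N)%N) -> mcoef (mfps_mul f g) s =
  \sum_(a : mbox n N) \sum_(b : mbox n N | mval a + mval b == s)
     mcoef f (mval a) * mcoef g (mval b).
Proof.
move=> hN; rewrite /= (big_mbox (fun u v => mcoef f u * mcoef g v) (leq_mdeg s) hN).
by rewrite pair_big_dep.
Qed.

Fact mfps_mulC : commutative mfps_mul.
Proof.
move=> f g; apply: mfpsP => s; rewrite !(mfps_mulE _ _ (leq_mdeg s)).
rewrite (exchange_big_dep predT) //=; apply: eq_bigr => b _.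
by apply: eq_big => a; rewrite 1?addrC // mulrC.
Qed.

Fact mfps_mulA : associative mfps_mul.
Proof.
move=> f g h; apply: mfpsP => s; have hs := leq_mdeg s.
set N := mdeg s in hs; pose B := mbox n N.
have uniq_mid (P : pred (mindex n)) (u : mindex n) (x : R) :
    (forall v, P v -> v = u -> forall i, (v i <= N)%N) ->
    \sum_(d : B | P (mval d) && (u == mval d)) x = if P u then x else 0.
  move=> hP; case: ifP => Pu; last first.
    by rewrite big1 // => d /andP[Pd /eqP ud]; rewrite ud Pd in Pu.
  have [d du] := mvalP (hP _ Pu erefl).
  rewrite (big_pred1 d) // => e; rewrite /= -du (inj_eq (@mval_inj _ _)) eq_sym.
  by case: eqP => [->|]; rewrite ?andbF // du Pu.
transitivity (\sum_(a : B) \sum_(b : B) \sum_(c : B)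
    if mval a + (mval b + mval c) == s
    then mcoef f (mval a) * (mcoef g (mval b) * mcoef h (mval c)) else 0).
  rewrite (mfps_mulE _ _ hs); apply: eq_bigr => a _.
  under eq_bigr => d _.
    rewrite (mfps_mulE _ _ (mval_le d)) mulr_sumr.
    under eq_bigr => b _ do rewrite mulr_sumr. over.
  rewrite exchange_big; apply: eq_bigr => b _ /=.
  rewrite (exchange_big_dep predT) //=; apply: eq_bigr => c _.
  by rewrite (uniq_mid (fun v => mval a + v == s)) // => v /eqP /maddr_le /(_ hs).
transitivity (\sum_(c : B) \sum_(a : B) \sum_(b : B)
    if mval a + mval b + mval c == s
    then mcoef f (mval a) * mcoef g (mval b) * mcoef h (mval c) else 0).
  rewrite [RHS]exchange_big; apply: eq_bigr => a _ /=.
  rewrite [RHS]exchange_big; apply: eq_bigr => b _ /=.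
  by apply: eq_bigr => c _; rewrite addrA mulrA.
rewrite mfps_mulC (mfps_mulE _ _ hs); apply: eq_bigr => c _; symmetry.
under eq_bigr => d _.
  rewrite (mfps_mulE _ _ (mval_le d)) mulr_sumr.
  under eq_bigr => a _ do rewrite mulr_sumr. over.
rewrite exchange_big; apply: eq_bigr => a _ /=.
rewrite (exchange_big_dep predT) //=; apply: eq_bigr => b _.
rewrite (uniq_mid (fun v => mval c + v == s)); last first.
  by move=> v /eqP /maddr_le /(_ hs).
by rewrite addrC mulrC.
Qed.

Fact mfps_mul1 : left_id mfps_one mfps_mul.
Proof.
move=> f; apply: mfpsP => s; rewrite (mfps_mulE _ _ (leq_mdeg s)).
have [e e0] : exists a : mbox n (mdeg s), mval a = 0.
  by apply: mvalP => i; rewrite ffunE.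
have [t ts] := mvalP (leq_mdeg s).
rewrite (bigD1 e) //= [X in _ + X]big1 ?addr0.
  rewrite (big_pred1 t) ?e0 ?eqxx ?mul1r ?ts // => b /=.
  by rewrite add0r -[in RHS](inj_eq (@mval_inj _ _)) ts.
move=> a ae; apply: big1 => b _.
by rewrite -e0 (inj_eq (@mval_inj _ _)) (negbTE ae) mul0r.
Qed.

Fact mfps_mulDl : left_distributive mfps_mul +%R.
Proof.
move=> f g h; apply: mfpsP => s /=; rewrite -big_split.
by apply: eq_bigr => p _; rewrite mulrDl.
Qed.

Fact mfps_one_neq0 : mfps_one != 0.
Proof.
apply/eqP => /(congr1 (fun f => mcoef f 0)) /eqP.
by rewrite /= eqxx oner_eq0.
Qed.

HB.instance Definition _ := GRing.Zmodule_isComNzRing.Build {mfps R[n]}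
  mfps_mulA mfps_mulC mfps_mul1 mfps_mulDl mfps_one_neq0.

Definition mfps_scale c f : {mfps R[n]} := MFPS (fun s => c * mcoef f s).

Fact mfps_scaleA a b f : mfps_scale a (mfps_scale b f) = mfps_scale (a * b) f.
Proof. by apply: mfpsP => s /=; rewrite mulrA. Qed.
Fact mfps_scale1 : left_id 1 mfps_scale.
Proof. by move=> f; apply: mfpsP => s /=; rewrite mul1r. Qed.
Fact mfps_scaleDr : right_distributive mfps_scale +%R.
Proof. by move=> c f g; apply: mfpsP => s /=; rewrite mulrDr. Qed.
Fact mfps_scaleDl f : {morph mfps_scale^~ f : a b / a + b}.
Proof. by move=> a b; apply: mfpsP => s /=; rewrite mulrDl. Qed.

HB.instance Definition _ := GRing.Zmodule_isLmodule.Build R {mfps R[n]}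
  mfps_scaleA mfps_scale1 mfps_scaleDr mfps_scaleDl.

Fact mfps_scaleAl c f g : c *: (f * g) = (c *: f) * g.
Proof.
apply: mfpsP => s /=; rewrite mulr_sumr.
by apply: eq_bigr => p _; rewrite mulrA.
Qed.

HB.instance Definition _ :=
  GRing.Lmodule_isLalgebra.Build R {mfps R[n]} mfps_scaleAl.
HB.instance Definition _ := GRing.Lalgebra_isComAlgebra.Build R {mfps R[n]}.

Lemma mcoef1 s : mcoef (1 : {mfps R[n]}) s = (s == 0)%:R. Proof. by []. Qed.
Lemma mcoefZ c f s : mcoef (c *: f) s = c * mcoef f s. Proof. by []. Qed.
Lemma mcoefM N f g s : (forall i, (s i <= N)%N) -> mcoef (f * g) s =
  \sum_(a : mbox n N) \sum_(b : mbox n N | mval a + mval b == s)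
     mcoef f (mval a) * mcoef g (mval b).
Proof. exact: mfps_mulE. Qed.

Lemma mcoef0M f g : mcoef (f * g) 0 = mcoef f 0 * mcoef g 0.
Proof.
have h i : ((0%R : mindex n) i <= 0)%N by rewrite ffunE.
have m0 (a : mbox n 0) : mval a = 0.
  by apply/ffunP => i; rewrite !ffunE ord1.
have [e _] := mvalP h.
rewrite (mcoefM _ _ h) (big_pred1 e) => [|a]; last first.
  by rewrite /= -(inj_eq (@mval_inj _ _)) !m0 eqxx.
rewrite (big_pred1 e) ?m0 // => a.
by rewrite /= -[in RHS](inj_eq (@mval_inj _ _)) !m0 addr0 !eqxx.
Qed.

Lemma mcoefX_low f k s : mcoef f 0 = 0 -> (mdeg s < k)%N ->
  mcoef (f ^+ k) s = 0.
Proof.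
move=> f0; elim: k s => // k IH s; rewrite ltnS => sk.
rewrite exprS (mcoefM _ _ (leq_mdeg s)) big1 // => a _.
rewrite big1 // => b /eqP abs.
have [->|a0] := eqVneq (mval a) 0; first by rewrite f0 mul0r.
rewrite IH ?mulr0 //; apply: leq_trans sk.
exact: mdeg_ltr abs a0.
Qed.

Definition mfpsX (i : 'I_n) : {mfps R[n]} :=
  MFPS (fun s => (s == [ffun j => (j == i) : nat])%:R).

End MFPSRing.

Section MFPSUnit.
Variables (R : comUnitRingType) (n : nat).
Implicit Types (f g h : {mfps R[n]}) (s : mindex n) (c : R).

(* Geometric series sum_k u^k, for u without constant term: the terms with
   k > mdeg s do not contribute to the coefficient at s. *)
Definition mfps_geom f : {mfps R[n]} :=
  MFPS (fun s => \sum_(k < (mdeg s).+1) mcoef (f ^+ k) s).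

Lemma mfps_geomP f : mcoef f 0 = 0 -> (1 - f) * mfps_geom f = 1.
Proof.
move=> f0; apply: mfpsP => s.
transitivity (mcoef ((1 - f) * \sum_(k < (mdeg s).+1) f ^+ k) s).
  rewrite !(mcoefM _ _ (leq_mdeg s)); apply: eq_bigr => a _.
  apply: eq_bigr => b /eqP abs; congr (_ * _); rewrite mcoef_sum /=.
  have bs : (mdeg (mval b) <= mdeg s)%N.
    exact: mdeg_ler abs.
  rewrite (big_ord_widen (mdeg s).+1 (fun k => mcoef (f ^+ k) (mval b))) //.
  rewrite big_mkcond; apply: eq_bigr => k _; case: ifPn => //.
  by rewrite -leqNgt => /(mcoefX_low f0) ->.
rewrite -opprB mulNr -subrX1 opprB mcoefB (mcoefX_low f0) ?ltnSn //.
by rewrite subr0.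
Qed.

Definition mfps_unit : {pred {mfps R[n]}} :=
  fun f => mcoef f 0 \is a GRing.unit.

Definition mfps_inv f : {mfps R[n]} :=
  if f \in mfps_unit
  then (mcoef f 0)^-1 *: mfps_geom (1 - (mcoef f 0)^-1 *: f) else f.

Fact mfps_mulV : {in mfps_unit, left_inverse 1 mfps_inv *%R}.
Proof.
move=> f fU; rewrite /mfps_inv fU; set c := (mcoef f 0)^-1.
rewrite -scalerAl scalerAr mulrC -{1}[c *: f](subKr 1) mfps_geomP //.
by rewrite mcoefB mcoefZ mcoef1 eqxx mulVr ?subrr.
Qed.

Fact mfps_unitPl f g : g * f = 1 -> mfps_unit f.
Proof.
move=> /(congr1 (fun h => mcoef h 0)); rewrite mcoef0M mcoef1 eqxx => gf.
by apply/unitrPr; exists (mcoef g 0); rewrite mulrC.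
Qed.

Fact mfps_inv_out : {in [predC mfps_unit], mfps_inv =1 id}.
Proof. by move=> f; rewrite inE /mfps_inv => /negbTE ->. Qed.

HB.instance Definition _ := GRing.ComNzRing_hasMulInverse.Build {mfps R[n]}
  mfps_mulV mfps_unitPl mfps_inv_out.

End MFPSUnit.

Definition gbinom (F : fieldType) (b : F) (k : nat) : F :=
  (\prod_(i < k) (b - i%:R)) / k`!%:R.

(* f^b for f with constant term 1, by the binomial series
   (1 + u)^b = sum_k gbinom b k u^k with u = f - 1: as u has no constant term,
   the terms with k > mdeg s do not contribute to the coefficient at s. *)
Definition mfps_pow (F : fieldType) n (f : {mfps F[n]}) (b : F) : {mfps F[n]} :=
  MFPS (fun s => \sum_(k < (mdeg s).+1) gbinom b k * mcoef ((f - 1) ^+ k) s).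

(* Euler's integral; meaningful for 0 < x. *)
Definition Gamma (R : realType) (x : R) : R :=
  \int[@lebesgue_measure R]_(t in `]0%R, +oo[%classic)
     (t `^ (x - 1) * expR (- t)).

Definition subfamily n (s : mindex n) (k : 'I_n) :=
  {dffun forall i : {i : 'I_n | i != k}, 'I_(s (val i)).+1}.

Definition Ssum (R : realType) (n : nat) (z : 'I_n -> R[i]) (alpha : R)
    (s : mindex n) : R[i] :=
  \sum_(k < n) z k ^+ (s k).+1 *
    \sum_(j : subfamily s k)
      (Gamma (alpha + (s k)%:R + (\sum_i (j i : nat))%N%:R + 1) /
        (Gamma (alpha + 1) * (s k)`!%:R * \prod_i (j i)`!%:R))%:C%C *
      \prod_i z (val i) ^+ j i.

(* Main.v *)
(* Write [u] for [z_1 t_1 + ... + z_n t_n] and [G] for [(1 - u)^(- alpha - 1)],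
   whose coefficient at [t^j] is [(alpha + 1)_|j| z^j / j!] by the multinomial
   theorem.  As [Gamma(alpha + m + 1) / Gamma(alpha + 1) = (alpha + 1)_m], the
   [k]-th term of [S_s] is [z_k] times the sum of the coefficients of [G] at the
   [j <= s] with [j_k = s_k], that is the coefficient at [t^s] of
   [z_k G prod_(i != k) 1 / (1 - t_i)].  Summing over [k] multiplies
   [G prod_i 1 / (1 - t_i)] by [sum_k z_k (1 - t_k)], and this factor is [1 - u]
   because the [z_k] sum to [1]. *)
Require Import Defs.
From HB Require Import structures.
From mathcomp Require Import all_boot all_order all_algebra.
From mathcomp Require Import all_classical all_reals all_analysis.
From mathcomp.real_closed Require Import complex.
From mathcomp Require Import measurable_realfun ring lra.

Set Implicit Arguments.
Unset Strict Implicit.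
Unset Printing Implicit Defensive.

Import Order.TTheory GRing.Theory Num.Theory.
Import numFieldNormedType.Exports.

Local Open Scope ring_scope.

(** * The Gamma integral: integrability, functional equation and positivity on [1, +oo) *)

Section GammaFunction.
Context {R : realType}.
Notation mu := (@lebesgue_measure R).
Implicit Types a b c t x : R.
Local Open Scope classical_set_scope.

(** Half of the exponential decay absorbs the power, [t^a exp(- t / 2)] being bounded. The remaining
    half dominates the integrand and gives its integrability and its limit at infinity. *)
Lemma powR_expR_le a : 0 <= a ->
  exists2 c, 0 < c &
    forall t, 0 <= t -> t `^ a * expR (- t) <= c * expR (- (t / 2)).
Proof.
move=> a0; set m := Num.bound a.
have am : a <= m.+1%:R.
  by rewrite -natr1 ler_wpDr// ltW// archi_boundP.
have c0 : 0 <= 2 ^+ m.+1 * m.+1`!%:R :> R by rewrite mulr_ge0// exprn_ge0.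
(* The summand 1 serves [t <= 1]; the other comes from the term of degree [m.+1] in the exponential
   series at [t / 2]. *)
exists (1 + 2 ^+ m.+1 * m.+1`!%:R); first by rewrite ltr_pwDl.
move=> t t0; rewrite [in leRHS](_ : - (t / 2) = t / 2 + - t); last lra.
rewrite expRD mulrA ler_wpM2r ?expR_ge0//.
have t20 : 0 <= t / 2 by rewrite divr_ge0.
have e1 : 1 <= expR (t / 2) by rewrite -[leLHS]expR0 ler_expR.
have [t1|/ltW t1] := leP t 1.
  apply: (@le_trans _ _ 1).
    have <- : 1 `^ a = 1 by rewrite powR1.
    by apply: ge0_ler_powR; rewrite ?nnegrE.
  by rewrite -[leLHS]mulr1 ler_pM// lerDl.
apply: (@le_trans _ _ (t ^+ m.+1)).
  by rewrite -powR_mulrn// ler_powR.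
have := expR_ge1Dxn m t20.
rewrite expr_div_n; set e := expR _ in e1 *; set f := (_`!)%:R => h.
have f0 : 0 < f by rewrite ltr0n fact_gt0.
have p0 : 0 < 2 ^+ m.+1 :> R by rewrite exprn_gt0.
have : t ^+ m.+1 / 2 ^+ m.+1 / f <= e by apply: le_trans h; rewrite lerDr.
rewrite ler_pdivrMr// ler_pdivrMr// => h2.
have {}h2 : t ^+ m.+1 <= 2 ^+ m.+1 * f * e by rewrite -mulrA mulrC [f * e]mulrC.
by apply: (le_trans h2); rewrite mulrDl lerDr mul1r (le_trans _ e1).
Qed.

Lemma within_continuous_powR a : 0 <= a ->
  {within `[0, +oo[, continuous (@powR R ^~ a)}.
Proof.
(* With exponent 0 the power is 1 even at the origin, whereas positive exponents give 0 there; hence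
   the separate case. *)
rewrite le_eqVlt => /predU1P[<-|a0].
  rewrite (_ : @powR R ^~ 0 = cst 1); first exact: cst_continuous.
  by apply/funext => t; rewrite powRr0.
apply/continuous_within_itvcyP; split.
  move=> t t0; apply/differentiable_continuous/derivable1_diffP.
  by apply: derivable_powR; rewrite inE/= in t0 *.
by rewrite powR0 ?gt_eqF//; exact: powR_cvg0.
Qed.

Lemma continuous_expRN : continuous (fun t : R => expR (- t)).
Proof.
move=> t.
by apply: continuous_comp; [exact: oppr_continuous|exact: continuous_expR].
Qed.

Lemma continuous_expR_half : continuous (fun t : R => expR (- (t / 2))).
Proof.
move=> t; apply: continuous_comp; last exact: continuous_expR.
by apply: continuousN; exact: mulrr_continuous.
Qed.

Lemma measurable_powR_expR a (D : set R) :
  measurable_fun D (fun t : R => t `^ a * expR (- t)).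
Proof.
apply/measurable_funTS/measurable_funM => //.
by apply: continuous_measurable_fun; exact: continuous_expRN.
Qed.

Lemma within_continuous_powR_expR a : 0 <= a ->
  {within `[0, +oo[, continuous (fun t : R => t `^ a * expR (- t))}.
Proof.
move=> a0 t; have ha := within_continuous_powR a0 (x := t).
have he : {within `[0, +oo[, continuous (fun u : R => expR (- u))}.
  exact: continuous_subspaceT continuous_expRN.
exact: cvgM ha (he t).
Qed.

Lemma cvg_expR_half : expR (- (t / 2)) @[t --> +oo] --> (0 : R).
Proof.
have h : (fun t : R => t / 2) t @[t --> +oo] --> +oo by exact: gt0_cvgMly.
exact: (cvg_comp _ _ h (@cvgr_expR R)).
Qed.

Lemma cvg_powR_expR a : 0 <= a -> t `^ a * expR (- t) @[t --> +oo] --> (0 : R).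
Proof.
move=> a0; have [c c0 hc] := powR_expR_le a0.
apply: (@squeeze_cvgr _ _ _ _ (cst 0) (fun t => c * expR (- (t / 2)))).
- near=> t; have t0 : 0 <= t by near: t; exact: nbhs_pinfty_ge.
  by rewrite mulr_ge0 ?powR_ge0 ?expR_ge0//= hc.
- exact: cvg_cst.
- rewrite -[X in _ --> X](mulr0 c); apply: cvgM; first exact: cvg_cst.
  exact: cvg_expR_half.
Unshelve. all: by end_near. Qed.

Lemma integral_expR_half :
  mu.-integrable `[0, +oo[ (fun t : R => (expR (- (t / 2)))%:E) /\
  \int[mu]_(t in `[0, +oo[) expR (- (t / 2)) = 2.
Proof.
have ce := continuous_expR_half.
have dF t : is_derive t 1 (fun t : R => - 2 * expR (- (t / 2)))
    (expR (- (t / 2))).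
  apply: is_derive_eq; rewrite /GRing.scale/=; lra.
have E : (\int[mu]_(t in `[0%R, +oo[) (expR (- (t / 2)))%:E = 2%:E)%E.
  rewrite (@ge0_continuous_FTC2y _ _ (fun t : R => - 2 * expR (- (t / 2))) _ 0).
  - by rewrite -EFinB mul0r oppr0 expR0; congr EFin; lra.
  - by move=> *; exact: expR_ge0.
  - exact: continuous_subspaceT.
  - rewrite -[X in _ --> X](mulr0 (- 2)); apply: cvgM; first exact: cvg_cst.
    exact: cvg_expR_half.
  - by move=> t _; exact: ex_derive.
  - apply: cvg_at_right_filter; apply: cvgM; first exact: cvg_cst.
    exact: ce.
  - by move=> t _; rewrite derive1E derive_val.
split; last by rewrite /Rintegral E.
apply/integrableP; split.
  apply/measurable_EFinP; apply: measurable_funTS.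
  exact: continuous_measurable_fun.
under eq_integral do rewrite /= ger0_norm ?expR_ge0//.
by rewrite E ltry.
Qed.

Lemma integrable_powR_expR a : 0 <= a ->
  mu.-integrable `[0, +oo[ (fun t : R => (t `^ a * expR (- t))%:E).
Proof.
move=> a0; have [c c0 hc] := powR_expR_le a0.
have [ie _] := integral_expR_half.
apply: (le_integrable _ _ _ (integrableZl _ c ie)) => //.
  by apply/measurable_EFinP; exact: measurable_powR_expR.
move=> t /=; rewrite in_itv/= andbT => t0; rewrite lee_fin.
by rewrite !ger0_norm ?mulr_ge0 ?powR_ge0 ?expR_ge0 ?(ltW c0)// hc.
Qed.

Lemma Gamma_itvcy x :
  Gamma x = \int[mu]_(t in `[0, +oo[) (t `^ (x - 1) * expR (- t)).
Proof.
rewrite /Gamma /Rintegral integral_itv_obnd_cbnd//.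
by apply/measurable_EFinP; exact: measurable_powR_expR.
Qed.

(* Adding a large multiple of [expR (- (t / 2))] makes the derivative of
   [- t `^ x * expR (- t)] nonnegative, as the fundamental theorem of calculus
   on a half-line requires. *)
Lemma Gamma_add1 x : 1 <= x -> Gamma (x + 1) = x * Gamma x.
Proof.
move=> x1; have x0 : 0 <= x by exact: le_trans x1.
have xB0 : 0 <= x - 1 by rewrite subr_ge0.
have [c c0 hc] := powR_expR_le xB0.
have [ie Ee] := integral_expR_half.
rewrite !Gamma_itvcy addrK.
have ix := integrable_powR_expR x0; have ixB := integrable_powR_expR xB0.
pose e t : R := expR (- (t / 2)).
pose g b t : R := t `^ b * expR (- t).
pose f t : R := g x t - x * g (x - 1) t + x * c * e t.
pose F t : R := - g x t - 2 * x * c * e t.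
have ce : continuous e by exact: continuous_expR_half.
have cg b : 0 <= b -> {within `[0, +oo[, continuous (g b)}.
  exact: within_continuous_powR_expR.
have dF t : 0 < t -> is_derive t 1 F (f t).
  move=> t0; have dx := is_derive1_powR x t0.
  rewrite /F /g /e; apply: is_derive_eq; rewrite /f /g /e /GRing.scale/=; lra.
have If : \int[mu]_(t in `[0, +oo[) f t = 2 * x * c.
  rewrite (@Rintegral_ge0_continuous_FTC2y _ _ F _ 0).
  - rewrite /F /g /e mul0r oppr0 expR0 powR0 ?gt_eqF ?(lt_le_trans _ x1)//; lra.
  - move=> t t0; rewrite /f addrAC -addrA.
    rewrite addr_ge0 ?mulr_ge0 ?powR_ge0 ?expR_ge0//.
    by rewrite -mulrA -mulrBr mulr_ge0// subr_ge0 hc.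
  - move=> t; apply: cvgD; first apply: cvgB; first exact: cg.
      by apply: cvgM; [exact: cvg_cst|exact: cg].
    by apply: cvgM; [exact: cvg_cst|exact: (continuous_subspaceT ce)].
  - rewrite -[X in _ --> X](_ : - 0 - 2 * x * c * 0 = 0); last lra.
    apply: cvgB; first by apply: cvgN; exact: cvg_powR_expR.
    by apply: cvgM; [exact: cvg_cst|exact: cvg_expR_half].
  - by move=> t t0; have dFt := dF _ t0; exact: ex_derive.
  - apply: cvgB.
      by apply: cvgN; have /continuous_within_itvcyP[] := cg _ x0.
    by apply: cvgM; [exact: cvg_cst|apply: cvg_at_right_filter; exact: ce].
  - move=> t; rewrite in_itv/= andbT => t0; have ? := dF _ t0.
    by rewrite derive1E derive_val.
(* The boundary value [2 * x * c] cancels against the integral of [x * c * e t], as [e] has integral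
   2; what is left is [Gamma (x + 1) - x * Gamma x = 0]. *)
move: If; rewrite /f RintegralD//; last 2 first.
- exact: (integrableB _ ix (integrableZl _ x ixB)).
- exact: (integrableZl _ (x * c) ie).
rewrite RintegralB//; last exact: (integrableZl _ x ixB).
rewrite RintegralZl// RintegralZl// [in X in _ + X]Ee.
rewrite /g; lra.
Qed.

(** On [1, 2] the integrand is at least [expR (- 2)], because [x - 1 >= 0] and [t >= 1]; the
    interval has length 1, so this constant bounds the integral from below. *)
Lemma Gamma_gt0 x : 1 <= x -> 0 < Gamma x.
Proof.
move=> x1; have xB0 : 0 <= x - 1 by rewrite subr_ge0.
have ix := integrable_powR_expR xB0.
have mg (D : set R) :
    measurable_fun D (fun t => (t `^ (x - 1) * expR (- t))%:E).
  by apply/measurable_EFinP; exact: measurable_powR_expR.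
apply: (@lt_le_trans _ _ (expR (- 2))); first exact: expR_gt0.
rewrite Gamma_itvcy -lee_fin /Rintegral fineK; last exact: integrable_fin_num.
have le12 : (`[1, 2] : set R) `<=` `[0, +oo[.
  by move=> t /=; rewrite !in_itv/= andbT => /andP[t1 _]; exact: le_trans t1.
apply: le_trans (ge0_subset_integral mu _ _ (mg _) _ le12) => //; last first.
  by move=> t _; rewrite lee_fin mulr_ge0 ?powR_ge0 ?expR_ge0.
apply: (@le_trans _ _ (\int[mu]_(t in `[1%R, 2%R]) (expR (- 2))%:E)%E).
  rewrite integral_cst//= lebesgue_measure_itv/= lte_fin ltr1n -EFinB.
  by rewrite -EFinM lee_fin (_ : 2 - 1 = 1) ?mulr1; lra.
apply: ge0_le_integral => //; first exact: mg.
move=> t /=; rewrite in_itv/= => /andP[t1 t2]; rewrite lee_fin.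
rewrite -[leLHS]mul1r ler_pM ?expR_ge0//; last by rewrite ler_expR lerN2.
by rewrite -[leLHS](powRr0 t) ler_powR.
Qed.

End GammaFunction.

(** * Multiplication of a power series by one variable *)

Section MFPSCoef.
Variables (R : comNzRingType) (n : nat).
Implicit Types (f g : {mfps R[n]}) (s t : mindex n) (i k : 'I_n).

Definition munit i : mindex n := [ffun j => (j == i) : nat].

(** Subtraction is truncated: if [s i = 0] this is [s] itself, hence the hypothesis [0 < s i]
    below. *)
Definition mpred s i : mindex n := [ffun j => (s j - (j == i))%N].

Lemma mpredK s i : (0 < s i)%N -> munit i + mpred s i = s.
Proof.
move=> si; apply/ffunP => j; rewrite !ffunE /=.
by case: eqP => [->|_]; [exact: subnKC|rewrite subn0; exact: add0n].
Qed.

Lemma munitK i : cancel (+%R (munit i)) (mpred^~ i).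
Proof. by move=> t; apply/ffunP => j; rewrite !ffunE addKn. Qed.

Lemma mdeg_munit i : mdeg (munit i) = 1%N.
Proof.
rewrite /mdeg (bigD1 i)//= ffunE eqxx big1// => j /negbTE ji.
by rewrite ffunE ji.
Qed.

Lemma mdeg_mpred s i : (0 < s i)%N -> (mdeg (mpred s i)).+1 = mdeg s.
Proof. by move=> si; rewrite -[in RHS](mpredK si) mdegD mdeg_munit. Qed.

Lemma mcoefXM i f s : mcoef (mfpsX R i * f) s =
  if (0 < s i)%N then mcoef f (mpred s i) else 0.
Proof.
rewrite (mcoefM _ _ (leq_mdeg s)); case: ifPn => [si|].
  have E := mpredK si.
  have [a aE] := mvalP (maddl_le E (leq_mdeg s)).
  have [b bE] := mvalP (maddr_le E (leq_mdeg s)).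
  rewrite (bigD1 a)//= [X in _ + X]big1 ?addr0; last first.
    move=> c; rewrite -(inj_eq (@mval_inj _ _)) aE => /negbTE ca.
    by rewrite big1// => d _; rewrite ca mul0r.
  rewrite (big_pred1 b) ?aE ?bE ?eqxx ?mul1r// => d /=.
  rewrite -(inj_eq (@mval_inj _ _)) bE; apply/eqP/eqP => [|->//].
  by move/(congr1 (mpred^~ i)); rewrite munitK.
rewrite -eqn0Ngt => /eqP si; rewrite big1// => a _; rewrite big1// => b /eqP E.
rewrite [mcoef _ _](_ : _ = 0) ?mul0r//=; case: eqP => // aE.
by move: si; rewrite -E aE !ffunE eqxx.
Qed.

End MFPSCoef.

(** * Powers of the linear form [u] and binomial series in it *)

Section LinearForm.
Variables (F : numFieldType) (n : nat) (z : 'I_n -> F).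
Implicit Types (s : mindex n).

Let u : {mfps F[n]} := \sum_(i < n) z i *: mfpsX _ i.

(** The coefficient of [t^s] in [exp u]; its multiples by functions of the total degree describe the
    power series in [u]. *)
Definition mmonom s : F := \prod_i (z i ^+ s i / (s i)`!%:R).

Lemma mmonom_mpred s i : (0 < s i)%N ->
  z i * mmonom (mpred s i) = (s i)%:R * mmonom s.
Proof.
move=> si; rewrite /mmonom (bigD1 i)//= [in RHS](bigD1 i)//= !mulrA.
congr (_ * _); last first.
  by apply: eq_bigr => j /negbTE ji; rewrite ffunE ji subn0.
rewrite ffunE eqxx subn1 -(prednK si) exprS factS natrM /=.
move: (s i).-1 => p.
have : p`!%:R != 0 :> F by rewrite pnatr_eq0 -lt0n fact_gt0.
have : p.+1%:R != 0 :> F by rewrite pnatr_eq0.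
move: (p`!%:R : F) (p.+1%:R : F) => a b b0 a0.
by field; rewrite a0 b0.
Qed.

Lemma mcoef_linM f s : mcoef (u * f) s =
  \sum_i if (0 < s i)%N then z i * mcoef f (mpred s i) else 0.
Proof.
rewrite /u mulr_suml mcoef_sum; apply: eq_bigr => i _.
by rewrite -scalerAl mcoefZ mcoefXM; case: ifP; rewrite ?mulr0.
Qed.

(** By [mmonom_mpred] the i-th term gets the weight [s i], and these weights add up to the total
    degree. In degree 0 the factor [(mdeg s)%:R] makes the default value of [(mdeg s).-1]
    harmless. *)
Lemma mcoef_linM_mmonom (c : nat -> F) f s :
  (forall t, mcoef f t = c (mdeg t) * mmonom t) ->
  mcoef (u * f) s = (mdeg s)%:R * c (mdeg s).-1 * mmonom s.
Proof.
move=> fE; rewrite mcoef_linM {1}/mdeg natr_sum !mulr_suml.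
apply: eq_bigr => i _; case: ifPn => [si|].
  by rewrite fE -(mdeg_mpred si)/= mulrCA mmonom_mpred// mulrCA mulrA.
by rewrite -eqn0Ngt => /eqP ->; rewrite !mul0r.
Qed.

(** The multinomial theorem, obtained by repeated multiplication by [u]. *)
Lemma mcoef_linX k s : mcoef (u ^+ k) s = (mdeg s == k)%:R * k`!%:R * mmonom s.
Proof.
elim: k s => [|k IH] s.
  rewrite expr0 mcoef1 mdeg_eq0; case: eqP => [->|_]; last by rewrite !mul0r.
  by rewrite /mmonom big1 ?mulr1// => i _; rewrite ffunE expr0 divr1.
rewrite exprS (mcoef_linM_mmonom (c := fun m => (m == k)%:R * k`!%:R))//.
case: (mdeg s) => [|m] /=; first by rewrite !mul0r.
rewrite eqSS; case: eqP => [->|_]; last by rewrite !(mul0r, mulr0).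
by rewrite !mul1r factS natrM.
Qed.

(** The Pochhammer symbol [(b)_k]. *)
Definition rising (b : F) k := \prod_(i < k) (b + i%:R).

Lemma gbinomN (b : F) k : gbinom (- b) k = (-1) ^+ k * rising b k / k`!%:R.
Proof.
rewrite /gbinom /rising; under eq_bigr do rewrite -opprD.
by rewrite prodrN card_ord.
Qed.

(** Since [u ^+ k] is homogeneous of degree [k], only the last term of the truncated binomial series
    survives; there the two signs [(-1) ^+ k] cancel, and so do the factorials. *)
Lemma mcoef_pow_lin b s :
  mcoef (mfps_pow (1 - u) (- b)) s = rising b (mdeg s) * mmonom s.
Proof.
have uE : 1 - u - 1 = -1 *: u by rewrite addrAC subrr add0r scaleN1r.
have m0 : (mdeg s)`!%:R != 0 :> F by rewrite pnatr_eq0 -lt0n fact_gt0.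
rewrite /= (bigD1 ord_max)//= [X in _ + X]big1 ?addr0.
  rewrite uE exprZn mcoefZ mcoef_linX eqxx gbinomN mul1r.
  move: (sqrr_sign F (mdeg s)) m0 (rising _ _) (mmonom s).
  move: ((-1) ^+ _) ((_`!)%:R) => e f e2 f0 r m.
  by transitivity (e ^+ 2 * (r * m)); [field|rewrite e2 mul1r].
move=> k /negbTE km; rewrite uE exprZn mcoefZ mcoef_linX.
by rewrite [_ == _](_ : _ = false) ?mul0r ?mulr0// eq_sym; exact: km.
Qed.

Lemma rising_add1 b k : rising b k.+1 = b * rising (b + 1) k.
Proof.
rewrite /rising big_ord_recl addr0; congr (_ * _).
by apply: eq_bigr => i _; rewrite -addrA nat1r.
Qed.

(** Coefficientwise, with the common factor [mmonom z s] pulled out, this is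
    [(b)_m = (b + 1)_m - m (b + 1)_(m - 1)]. *)
Lemma mfps_pow_linD1 b :
  mfps_pow (1 - u) (- b) = (1 - u) * mfps_pow (1 - u) (- (b + 1)).
Proof.
apply: mfpsP => s; rewrite mulrBl mul1r mcoefB.
rewrite (mcoef_linM_mmonom (c := rising (b + 1))); last exact: mcoef_pow_lin.
rewrite !mcoef_pow_lin -mulrBl; congr (_ * _).
case: (mdeg s) => [|m]; first by rewrite mul0r subr0 /rising !big_ord0.
rewrite rising_add1 /= [in X in X - _]/rising big_ord_recr /= -/(rising _ _).
rewrite -natr1; ring.
Qed.

End LinearForm.

(** * Products of geometric series as sums over boxes of exponents *)

Section BoxSum.
Variables (F : fieldType) (n : nat).
Implicit Types (f : {mfps F[n]}) (s t : mindex n) (i : 'I_n) (r : seq 'I_n).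

(** The list [r] holds the variables whose geometric series have been multiplied in; the exponents
    of the others stay fixed at those of [s]. *)
Definition below r s : pred (mindex n) := fun t =>
  [forall i, if i \in r then (t i <= s i)%N else t i == s i].

Lemma belowP r s t :
  reflect (forall i, if i \in r then (t i <= s i)%N else t i == s i)
    (below r s t).
Proof. exact: forallP. Qed.

Lemma below_cons_eq i r s t : i \notin r ->
  below (i :: r) s t && (t i == s i) = below r s t.
Proof.
move=> /negbTE ir; apply/andP/belowP => [[/belowP h /eqP ti] j|h].
  have := h j; rewrite in_cons.
  by case: (eqVneq j i) => [->|//]; rewrite ir ti eqxx.
split; last by have := h i; rewrite ir.
apply/belowP => j; have := h j; rewrite in_cons; case: (eqVneq j i) => [->|//].
by rewrite ir /= => /eqP ->.
Qed.

Lemma below_cons_neq i r s t :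
  below (i :: r) s t && (t i != s i) =
  (0 < s i)%N && below (i :: r) (mpred s i) t.
Proof.
apply/andP/andP => [[/belowP h ti]|[si /belowP h]].
  have := h i; rewrite mem_head leq_eqVlt (negbTE ti)/= => ltsi.
  split; first exact: leq_ltn_trans ltsi.
  apply/belowP => j; have := h j; rewrite in_cons ffunE.
  case: (eqVneq j i) => [->|]//=; last by rewrite subn0.
  by move=> _; rewrite subn1 -ltnS prednK// (leq_ltn_trans _ ltsi).
have := h i; rewrite mem_head ffunE eqxx subn1 -ltnS prednK// => ltsi.
split; last by rewrite ltn_eqF.
apply/belowP => j; have := h j; rewrite in_cons ffunE.
case: (eqVneq j i) => [->|_] /=; [by rewrite (ltnW ltsi)|by rewrite subn0].
Qed.

Lemma unit_1BX i : (1 - mfpsX F i : {mfps F[n]}) \is a GRing.unit.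
Proof.
have : mcoef (1 - mfpsX F i : {mfps F[n]}) 0 \is a GRing.unit.
  rewrite mcoefB mcoef1 eqxx [X in _ - X](_ : _ = 0) ?subr0 ?unitr1//=.
  by rewrite eq_sym -mdeg_eq0 mdeg_munit.
exact.
Qed.

(** Induction on [r] and, for each new variable [i], on [s i]: the box splits into the slice where
    the i-th exponent equals [s i] and the box with that side shortened by one. *)
Lemma mcoefM_geom r f N s : uniq r -> (forall i, (s i <= N)%N) ->
  mcoef (f * \prod_(i <- r) (1 - mfpsX _ i)^-1) s =
  \sum_(a : mbox n N | below r s (mval a)) mcoef f (mval a).
Proof.
elim: r s => [|i r IH] s.
  move=> _ sN; have [a aE] := mvalP sN.
  rewrite big_nil mulr1 (big_pred1 a) ?aE// => b /=.
  rewrite -(inj_eq (@mval_inj _ _)) aE.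
  apply/belowP/eqP => [h|-> j]; last by rewrite in_nil.
  by apply/ffunP => j; exact/eqP/h.
rewrite cons_uniq => /andP[ir ur]; have [m] := ubnP (s i).
elim: m s => // m IHm s sm sN.
set h := f * _.
have hE : (1 - mfpsX F i) * h = f * \prod_(i <- r) (1 - mfpsX _ i)^-1.
  by rewrite /h big_cons mulrCA mulVKr ?unit_1BX.
(* The first summand has lost the geometric series in [i] and yields the slice; the second lowers
   the i-th exponent and yields the shortened box. *)
have -> : h = (1 - mfpsX F i) * h + mfpsX F i * h by rewrite mulrBl mul1r subrK.
rewrite mcoefD mcoefXM hE IH//.
rewrite [RHS](bigID (fun a : mbox n N => mval a i == s i))/=.
congr (_ + _); first by apply: eq_bigl => a; rewrite below_cons_eq.
rewrite [RHS](eq_bigl _ _ (fun a => below_cons_neq i r s (mval a))).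
case: ifP => [si|_]; last by rewrite big_pred0.
rewrite -IHm//; first by rewrite ffunE eqxx subn1 -ltnS prednK.
by move=> j; rewrite ffunE (leq_trans (leq_subr _ _)).
Qed.

End BoxSum.

(** * The sums [Ssum] in terms of rising factorials and full multi-indices *)

Lemma Gamma_addn (R : realType) (x : R) m : 1 <= x ->
  Gamma (x + m%:R) = rising x m * Gamma x.
Proof.
move=> x1; elim: m => [|m IH]; first by rewrite addr0 /rising big_ord0 mul1r.
rewrite -natr1 addrA Gamma_add1 ?(le_trans x1) ?lerDl// IH.
by rewrite [rising x m.+1]big_ord_recr/= mulrA [_ * rising _ _]mulrC.
Qed.

Section Subfamily.
Variables (n : nat) (s : mindex n) (k : 'I_n).
Implicit Types j : subfamily s k.

(** [insub i] fails exactly at [i = k], where the missing entry is filled with [s k]. *)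
Definition mextend j : mindex n :=
  [ffun i => oapp (fun x : {i | i != k} => j x : nat) (s k) (insub i)].

Lemma mextend_eq j : mextend j k = s k.
Proof. by rewrite ffunE insubF ?eqxx. Qed.

Lemma mextend_val j (x : {i | i != k}) : mextend j (val x) = j x.
Proof. by rewrite ffunE valK. Qed.

Lemma big_neq (V : Type) (idx : V) (op : Monoid.com_law idx) (f : 'I_n -> V) :
  \big[op/idx]_(i | i != k) f i = \big[op/idx]_(x : {i | i != k}) f (val x).
Proof.
rewrite (reindex_omap (val : {i | i != k} -> 'I_n) insub) => [|i ik].
  by apply: eq_bigl => x; rewrite valK (valP x) eqxx.
by rewrite insubT.
Qed.

(** The filtered list omits only [k], so the box condition pins the k-th entry and bounds the others
    by [s], which is exactly the freedom of a [subfamily]. *)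
Lemma big_mextend (V : nmodType) N (f : mindex n -> V) :
  (forall i, (s i <= N)%N) ->
  \sum_(a : mbox n N | below [seq i <- index_enum 'I_n | i != k] s (mval a))
    f (mval a) = \sum_(j : subfamily s k) f (mextend j).
Proof.
move=> sN.
(* Both uses of [inord] keep the value: the entries of [mextend j] are at most [N], and those of an
   [a] in the sum are at most [s i]. *)
pose h j : mbox n N := [ffun i => inord (mextend j i)].
pose h' (a : mbox n N) : subfamily s k := [ffun x => inord (a (val x))].
have in_r i : (i \in [seq i <- index_enum 'I_n | i != k]) = (i != k).
  by rewrite mem_filter mem_index_enum andbT.
have mextend_le j i : (mextend j i <= s i)%N.
  rewrite ffunE; case: insubP => [x _ <-|/negPn/eqP ->]//=.
  by rewrite -ltnS.
have hE j : mval (h j) = mextend j.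
  apply/ffunP => i.
  by rewrite ffunE [h j i]ffunE inordK// ltnS (leq_trans (mextend_le j i)).
rewrite (reindex_onto h h').
  apply: eq_big => [j|j _]; last by rewrite hE.
  rewrite hE; apply/andP; split.
    apply/belowP => i; rewrite in_r; case: (eqVneq i k) => [->|_] /=.
      by rewrite mextend_eq.
    exact: mextend_le.
  apply/eqP/ffunP => x; rewrite ffunE [h j _]ffunE inordK.
    by rewrite mextend_val inord_val.
  by rewrite ltnS (leq_trans (mextend_le _ _)).
move=> a /belowP ha; apply/ffunP => i; rewrite ffunE; apply: val_inj => /=.
have := ha i; rewrite in_r ffunE; case: (eqVneq i k) => [->|ik] /= hi.
  by rewrite mextend_eq inordK ?ltnS// (eqP hi).
have /= -> := mextend_val (h' a) (Sub i ik : {i | i != k}).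
by rewrite ffunE /= [in X in inord X]inordK// inord_val.
Qed.

End Subfamily.

Lemma mdeg_mextend n (s : mindex n) k (j : subfamily s k) :
  mdeg (mextend j) = (s k + \sum_x j x)%N.
Proof.
rewrite /mdeg (bigD1 k)//= mextend_eq big_neq; congr addn.
by apply: eq_bigr => x _; rewrite mextend_val.
Qed.

Lemma mmonom_mextend (F : numFieldType) n (z : 'I_n -> F) (s : mindex n) k
    (j : subfamily s k) :
  mmonom z (mextend j) = z k ^+ s k / (s k)`!%:R *
    (\prod_x z (val x) ^+ j x / \prod_x (j x)`!%:R).
Proof.
rewrite /mmonom (bigD1 k)//= mextend_eq big_neq -prodf_div; congr (_ * _).
by apply: eq_bigr => x _; rewrite mextend_val.
Qed.

Lemma rising_rmorph (F G : numFieldType) (phi : {rmorphism F -> G}) b m :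
  phi (rising b m) = rising (phi b) m.
Proof.
by rewrite rmorph_prod; apply: eq_bigr => i _; rewrite rmorphD rmorph_nat.
Qed.

(** As [alpha + 1 >= 1], [Gamma (alpha + 1)] is nonzero and the Gamma quotient reduces to a rising
    factorial. One factor [z k] stays outside, and [z k ^+ s k] enters [mmonom]. *)
Lemma SsumE (R : realType) n (z : 'I_n -> R[i]) (alpha : R) (s : mindex n) :
  0 <= alpha ->
  Ssum z alpha s = \sum_k z k * \sum_(j : subfamily s k)
    rising (alpha%:C%C + 1) (mdeg (mextend j)) * mmonom z (mextend j).
Proof.
move=> alpha0; apply: eq_bigr => k _; rewrite !mulr_sumr.
apply: eq_bigr => j _.
have a1 : 1 <= alpha + 1 by rewrite lerDr.
have Ga := lt0r_neq0 (Gamma_gt0 a1).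
rewrite mdeg_mextend mmonom_mextend; set m := (\sum_x j x)%N.
have -> : alpha + (s k)%:R + m%:R + 1 = alpha + 1 + (s k + m)%N%:R :> R.
  by rewrite natrD; ring.
rewrite Gamma_addn//; set q := \prod_x (j x)`!%:R.
rewrite [_ * Gamma _]mulrC -[Gamma _ * _ * q]mulrA -mulf_div divff// mul1r.
rewrite rmorphM/= fmorphV rmorphM/= rmorph_nat (rising_rmorph (real_complex R)).
rewrite rmorphD rmorph1 rmorph_prod.
under [\prod_x _%:C%C]eq_bigr do rewrite rmorph_nat.
rewrite exprS invfM; ring.
Qed.

(** * The generating function, compared coefficient by coefficient *)

Theorem theorem9 (R : realType) (n : nat) (alpha : R) (z : 'I_n -> R[i])
    (n_ge1 : (1 <= n)%N) (alpha_ge0 : 0 <= alpha)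
    (sum_z : \sum_(i < n) z i = 1) :
  MFPS (fun s : {ffun 'I_n -> nat} => Ssum z alpha s) =
  mfps_pow (1 - \sum_(i < n) z i *: mfpsX _ i) (- alpha%:C%C) *
    \prod_(i < n) (1 - mfpsX _ i)^-1.
Proof.
apply: mfpsP => s; rewrite mfps_pow_linD1.
set u := \sum_(i < n) _; set G := mfps_pow _ _; set b := alpha%:C%C.
have uE : 1 - u = \sum_k z k *: (1 - mfpsX _ k).
  under eq_bigr do rewrite scalerBr.
  by rewrite sumrB -scaler_suml sum_z scale1r.
(* The factor [1 - t_k] from [1 - u] cancels the k-th inverse, so the k-th term keeps the geometric
   series of the other variables only. *)
have -> : (1 - u) * G * \prod_(i < n) (1 - mfpsX _ i)^-1 =
    \sum_k z k *: (G * \prod_(i <- [seq i <- index_enum 'I_n | i != k])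
      (1 - mfpsX _ i)^-1).
  rewrite uE !mulr_suml; apply: eq_bigr => k _.
  rewrite -!scalerAl big_filter [in LHS](bigD1 k)//=; congr (_ *: _).
  by rewrite mulrAC mulrA mulrV ?unit_1BX// mul1r mulrC.
rewrite [LHS]SsumE// mcoef_sum; apply: eq_bigr => k _; rewrite mcoefZ.
rewrite (mcoefM_geom _ _ (leq_mdeg s)) ?filter_uniq ?index_enum_uniq//.
rewrite big_mextend; last exact: leq_mdeg.
by congr (_ * _); apply: eq_bigr => j _; rewrite mcoef_pow_lin.
Qed.
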